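(* There is no algorithm which, given a deterministic one-tape Turing machine $M$ and a finite input word $w$ over the input alphabet of $M$, decides whether the trajectory of $M$ on $w$ is eventually periodic.
   Context: A deterministic (one-tape) Turing machine is a 7-tuple $M=(Q,\Sigma,\Gamma,\delta,q_0,q_{\mathrm{accept}},q_{\mathrm{reject}})$ where $Q,\Sigma,\Gamma$ are finite sets; $Q$ is the set of states; $\Sigma$ is the input alphabet, not containing the blank symbol $\sqcup$; $\Gamma$ is the tape alphabet, with $\sqcup\in\Gamma$ and $\Sigma\subseteq\Gamma$; $\delta:(Q\setminus\{q_{\mathrm{accept}},q_{\mathrm{reject}}\})\times\Gamma\to Q\times\Gamma\times\{\mathrm{L},\mathrm{R}\}$ is the transition function; $q_0\in Q$ is the start state; $q_{\mathrm{accept}},q_{\mathrm{reject}}\in Q$ are the halting states, with $q_{\mathrm{accept}}\ne q_{\mathrm{reject}}$. The tape is two-sided infinite, with cells indexed by $\mathbb{Z}$. Machines and words are given to an algorithm as finite strings under a standard encoding. A configuration is a triple $C=(\tau,h,q)$ consisting of a tape function $\tau:\mathbb{Z}\to\Gamma$ with finite nonblank support (i.e. $\tau(i)=\sqcup$ for all but finitely many $i$), a head position $h\in\mathbb{Z}$, and a state $q\in Q$. The trajectory map $T_M$ from configurations to configurations is: if $q\in\{q_{\mathrm{accept}},q_{\mathrm{reject}}\}$ then $T_M(C)=C$; otherwise, if $\delta(q,\tau(h))=(q',\gamma,D)$, then $T_M(C)$ has state $q'$, tape function equal to $\tau$ except that cell $h$ now holds $\gamma$, and head position $h-1$ if $D=\mathrm{L}$,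 $h+1$ if $D=\mathrm{R}$. The initial configuration of $M$ on input $w$ has $w$ written from cell $0$ to the right, all other cells blank, head at cell $0$, and state $q_0$. The trajectory of $M$ from an initial configuration $C_0$ (the trajectory of $M$ on $w$ when $C_0$ is the initial configuration on $w$) is eventually periodic if there exist integers $0\le k<l$ with $T_M^k(C_0)=T_M^l(C_0)$. In particular, halting trajectories are eventually periodic. *)

(* Defs.v *)
From mathcomp Require Import all_boot all_order all_algebra.
From mathcomp Require Import finmap.

Set Implicit Arguments.
Unset Strict Implicit.
Unset Printing Implicit Defensive.

Inductive direction := Left | Right.

Record turing_machine := TuringMachine {
  state : finType;
  tape_symbol : finType;
  blank : tape_symbol;
  input_alphabet : {set tape_symbol};
  blank_not_input : blank \notin input_alphabet;
  start : state;
  accept : state;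
  reject : state;
  accept_neq_reject : accept != reject;
  delta : {q : state | (q != accept) && (q != reject)} -> tape_symbol ->
          state * tape_symbol * direction
}.

Arguments blank : clear implicits.
Arguments start : clear implicits.
Arguments accept : clear implicits.
Arguments reject : clear implicits.

Definition input_symbol (M : turing_machine) :=
  {a : tape_symbol M | a \in input_alphabet M}.

Definition word (M : turing_machine) := seq (input_symbol M).

Section Trajectory.

Variable M : turing_machine.

(* Finitely supported functions are compared extensionally by Leibniz
   equality, hence so are configurations. *)
Definition tape := {fsfun int -> tape_symbol M of _ => blank M}.

Record config := Config {
  config_tape : tape;
  config_head : int;
  config_state : state M
}.

Definition write (t : tape) (h : int) (a : tape_symbol M) : tape :=
  [fsfun i in (h |` finsupp t)%fset => if i == h then a else t i | blank M].

Definition move (h : int) (d : direction) : int :=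
  match d with
  | Left => (h - 1)%R
  | Right => (h + 1)%R
  end.

(* [insub q] is [None] exactly when [q] is one of the two halting states. *)
Definition step (C : config) : config :=
  match insub (config_state C) with
  | Some q =>
      let: (q', a, d) := delta q (config_tape C (config_head C)) in
      Config (write (config_tape C) (config_head C) a)
             (move (config_head C) d) q'
  | None => C
  end.

Definition initial_tape (w : word M) : tape :=
  [fsfun i in [fset Posz n | n in iota 0 (size w)]%fset =>
     nth (blank M) [seq val a | a <- w] `|i|%N | blank M].

Definition initial (w : word M) : config :=
  Config (initial_tape w) 0%R (start M).

Definition eventually_periodic (w : word M) : Prop :=
  exists k l : nat, k < l /\ iter k step (initial w) = iter l step (initial w).

Definition accepts (w : word M) : Prop :=
  exists n, config_state (iter n step (initial w)) = accept M.

Definition rejects (w : word M) : Prop :=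
  exists n, config_state (iter n step (initial w)) = reject M.

End Trajectory.

(* Encoding of a machine and a word as a bit string.  States and tape symbols
   are numbered by the enumeration of their finite type.  The machine is listed
   as the numbers |Q|, |Gamma|, blank, |Sigma|, the elements of Sigma, q_0,
   q_accept, q_reject and then one quintuple (q, a, q', a', D) for each entry
   of the transition table; the word follows, symbol by symbol, up to the end
   of the string.  As q_accept and q_reject differ, the table has
   (|Q| - 2) * |Gamma| entries, so the list of numbers determines the machine
   (up to renaming of states and symbols) and the word.  Each number n is
   written as n ones followed by a zero, which is a prefix code. *)
Definition index_of (T : finType) (x : T) : nat := enum_rank x.

Definition direction_number (d : direction) : nat :=
  match d with
  | Left => 0
  | Right => 1
  end.

Definition transition_numbers (M : turing_machine)
    (q : {q : state M | (q != accept M) && (q != reject M)})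
    (a : tape_symbol M) : seq nat :=
  let: (q', a', d) := delta q a in
  [:: index_of (val q); index_of a;
      index_of q'; index_of a'; direction_number d].

Definition machine_numbers (M : turing_machine) : seq nat :=
  [:: #|state M|; #|tape_symbol M|; index_of (blank M); #|input_alphabet M|]
  ++ [seq index_of a | a <- enum (input_alphabet M)]
  ++ [:: index_of (start M); index_of (accept M); index_of (reject M)]
  ++ flatten [seq transition_numbers q a
             | q <- enum {: {q : state M | (q != accept M) && (q != reject M)}},
               a <- enum (tape_symbol M)].

Definition word_numbers (M : turing_machine) (w : word M) : seq nat :=
  [seq index_of (val a) | a <- w].

Definition bits (s : seq nat) : seq bool :=
  flatten [seq rcons (nseq n true) false | n <- s].

Definition encode (M : turing_machine) (w : word M) : seq bool :=
  bits (machine_numbers M ++ word_numbers w).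

(* An algorithm is a Turing machine [D] reading bit strings, the two bits being
   represented by the input symbols [bit true] and [bit false] of [D]; nothing
   is required of [D] on strings that encode no pair (M, w). *)
Definition decides (D : turing_machine) (bit : bool -> input_symbol D)
    (P : forall M : turing_machine, word M -> Prop) : Prop :=
  forall (M : turing_machine) (w : word M),
    (P M w -> accepts [seq bit b | b <- encode w]) /\
    (~ P M w -> rejects [seq bit b | b <- encode w]).

(* Main.v *)
(* Given a decider D, let E be the machine that, started on a bit string x,
   replaces it by x ++ c(x), where c(x) is the encoding of x as an input word of
   E, and then runs D on the result; if D accepts, E runs right forever, and if
   D rejects, E halts.  When x is the machine part of the encoding of E, the
   string x ++ c(x) is the encoding of the pair (E, x), so the trajectory of E
   on x is eventually periodic exactly when D answers that it is not. *)

Require Import Defs.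
From HB Require Import structures.
From mathcomp Require Import all_boot all_order all_algebra.
From mathcomp Require Import finmap.

Set Implicit Arguments.
Unset Strict Implicit.
Unset Printing Implicit Defensive.

Import GRing.Theory.

(** * Tapes and runs of an arbitrary machine *)

Section Machine.

Variable M : turing_machine.
Implicit Types (s : seq (tape_symbol M)) (a : tape_symbol M) (q : state M).

Lemma writeE (t : tape M) h a i : write t h a i = if i == h then a else t i.
Proof.
rewrite fsfunE in_fset1U; case: eqP => //= _.
by case: ifPn => // /fsfun_dflt ->.
Qed.

Lemma write_id (t : tape M) h : write t h (t h) = t.
Proof. by apply/fsfunP => i; rewrite writeE; case: eqP => [->|]. Qed.

Definition tape_of s : tape M :=
  [fsfun i in [fset Posz n | n in iota 0 (size s)]%fset =>
     nth (blank M) s `|i|%N | blank M].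

Lemma tape_ofE s i :
  tape_of s i = if i is Posz n then nth (blank M) s n else blank M.
Proof.
rewrite fsfunE; case: ifPn => [/imfsetP[n _ ->] //|].
case: i => // n /imfsetP ni; rewrite nth_default // leqNgt; apply/negP => lt_n.
by apply: ni; exists n => //=; rewrite mem_iota.
Qed.

Lemma initial_tapeE (w : word M) :
  initial_tape w = tape_of [seq val x | x <- w].
Proof. by rewrite /initial_tape /tape_of size_map. Qed.

Lemma write_tape_of s1 s2 a b :
  write (tape_of (s1 ++ a :: s2)) (size s1) b = tape_of (s1 ++ b :: s2).
Proof.
apply/fsfunP => i; rewrite writeE !tape_ofE.
case: i => // n; rewrite eqz_nat !nth_cat.
case: (ltngtP n (size s1)) => [//|gt_n|->]; last by rewrite subnn.
by case: (n - size s1) (subn_gt0 (size s1) n) => //; rewrite gt_n.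
Qed.

Lemma write_tape_of_end s b :
  write (tape_of s) (size s) b = tape_of (rcons s b).
Proof.
apply/fsfunP => i; rewrite writeE !tape_ofE; case: i => // n.
rewrite eqz_nat nth_rcons.
by case: (ltngtP n (size s)) => // gt_n; rewrite nth_default // ltnW.
Qed.

Definition reaches (C C' : config M) := exists n, iter n (@step M) C = C'.

Lemma reaches_refl C : reaches C C.
Proof. by exists 0. Qed.

Lemma reaches_trans C2 C1 C3 : reaches C1 C2 -> reaches C2 C3 -> reaches C1 C3.
Proof. by move=> [m <-] [n <-]; exists (n + m); rewrite iterD. Qed.

Lemma reaches_step C C' : reaches (step C) C' -> reaches C C'.
Proof. by apply: reaches_trans; exists 1. Qed.

Lemma step_halted (C : config M) :
  config_state C \in [:: accept M; reject M] -> step C = C.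
Proof.
by rewrite /step !inE => halted; rewrite insubN // negb_and !negbK.
Qed.

Lemma iter_step_halted (C : config M) n :
  config_state C \in [:: accept M; reject M] -> iter n (@step M) C = C.
Proof. by move=> halted; elim: n => //= n ->; apply: step_halted. Qed.

Section Total.

(* A total extension of [delta], avoiding the subtype of nonhalting states. *)
Variable f : state M -> tape_symbol M -> state M * tape_symbol M * direction.
Hypothesis fE :
  forall (p : {q : state M | (q != accept M) && (q != reject M)}) a,
  delta p a = f (val p) a.

Lemma stepE t h q : q != accept M -> q != reject M ->
  step (Config t h q) =
    Config (write t h (f q (t h)).1.2) (move h (f q (t h)).2) (f q (t h)).1.1.
Proof.
move=> qa qr; rewrite /step /=.
case: insubP => [p _ <-|]; last by rewrite qa qr.
by rewrite fE; case: (f _ _) => [[]].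
Qed.

Lemma scan_right q s1 s2 s3 : q != accept M -> q != reject M ->
    {in s2, forall a, f q a = (q, a, Right)} ->
  reaches (Config (tape_of (s1 ++ s2 ++ s3)) (size s1) q)
          (Config (tape_of (s1 ++ s2 ++ s3)) (size (s1 ++ s2)) q).
Proof.
move=> qa qr; elim: s2 s1 => [|a s2 IH] s1 scan.
  by rewrite cats0; apply: reaches_refl.
apply: reaches_step; rewrite stepE // tape_ofE nth_cat ltnn subnn /=.
rewrite scan ?mem_head //= write_tape_of.
have := IH (rcons s1 a); rewrite !cat_rcons size_rcons -addn1 PoszD; apply.
by move=> b bs; apply: scan; rewrite inE bs orbT.
Qed.

(** Head positions are integer differences because the scan stops at cell -1 when [s1] is empty. *)
Lemma scan_left q s1 s2 s3 : q != accept M -> q != reject M ->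
    {in s2, forall a, f q a = (q, a, Left)} ->
  reaches (Config (tape_of (s1 ++ s2 ++ s3)) (Posz (size (s1 ++ s2)) - 1)%R q)
          (Config (tape_of (s1 ++ s2 ++ s3)) (Posz (size s1) - 1)%R q).
Proof.
move=> qa qr; elim/last_ind: s2 s3 => [|s2 a IH] s3 scan.
  by rewrite cats0; apply: reaches_refl.
rewrite -rcons_cat size_rcons -addn1 PoszD addrK.
apply: reaches_step; rewrite stepE // cat_rcons catA.
rewrite tape_ofE nth_cat ltnn subnn /=.
rewrite scan ?mem_rcons ?mem_head //= write_tape_of -catA.
by apply: IH => b bs; apply: scan; rewrite mem_rcons inE bs orbT.
Qed.

End Total.

End Machine.

(** The [index] form computes on an explicitly listed enumeration, unlike [enum_rank]. *)
Lemma index_of_enum (T : finType) (x : T) : index x (enum T) = index_of x.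
Proof.
by rewrite -{1}(nth_enum_rank x x) index_uniq ?enum_uniq // -cardE ltn_ord.
Qed.

(** * The diagonal machine *)

Inductive phase := Fetch | Append of bool | Back | Rewind | Halt.

(** Nested options over [bool] form a finite type, and [phase] inherits finiteness through this
    injection. *)
Definition phase_code (p : phase) : option (option (option (option bool))) :=
  match p with
  | Fetch => None
  | Back => Some None
  | Rewind => Some (Some None)
  | Halt => Some (Some (Some None))
  | Append b => Some (Some (Some (Some b)))
  end.

Definition phase_decode (c : option (option (option (option bool)))) : phase :=
  match c with
  | None => Fetch
  | Some None => Back
  | Some (Some None) => Rewind
  | Some (Some (Some None)) => Halt
  | Some (Some (Some (Some b))) => Append b
  end.

Lemma phase_codeK : cancel phase_code phase_decode.
Proof. by case. Qed.

HB.instance Definition _ := Finite.copy phase (can_type phase_codeK).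

Section Diagonal.

Variables (D : turing_machine) (bit : bool -> input_symbol D).

Definition digit (b : bool) : bool + tape_symbol D := inr (val (bit b)).

(* The input symbols [inl b] are bits still to be copied.  The code of [inl b]
   is [1^(~~ b) 0]: it is appended by [Append b]. *)
Definition diagonal_delta (q : phase + state D) (c : bool + tape_symbol D) :
    (phase + state D) * (bool + tape_symbol D) * direction :=
  match q, c with
  | inl Fetch, inl b => (inl (Append b), digit b, Right)
  | inl (Append b), inr a =>
      if a == blank D then
        if b then (inl Back, digit false, Left)
        else (inl (Append true), digit true, Right)
      else (q, c, Right)
  | inl Back, inl _ => (inl Rewind, c, Left)
  | inl Back, inr a =>
      if a == blank D then (inr (start D), c, Right) else (q, c, Left)
  | inl Rewind, inl _ => (q, c, Left)
  | inl Rewind, inr _ => (inl Fetch, c, Right)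
  | inr p, inr a =>
      if insub p is Some p' then
        let: (p'', a', d) := delta p' a in (inr p'', inr a', d)
      else (q, c, Right)
  | _, _ => (q, c, Right)
  end.

Definition is_inl (A B : Type) (x : A + B) :=
  if x is inl _ then true else false.

Lemma blank_not_inl :
  inr (blank D) \notin [set c : bool + tape_symbol D | is_inl c].
Proof. by rewrite inE. Qed.

Lemma halt_neq_reject : inl Halt != inr (reject D) :> phase + state D.
Proof. by []. Qed.

(* The accepting state of [D] is not halting here: the head then runs right. *)
Definition diagonal : turing_machine :=
  @TuringMachine (phase + state D)%type (bool + tape_symbol D)%type
    (inr (blank D)) [set c | is_inl c] blank_not_inl
    (inl Fetch) (inl Halt) (inr (reject D)) halt_neq_reject
    (fun q => diagonal_delta (val q)).

Lemma diagonal_deltaE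
    (q : {q : state diagonal |
            (q != accept diagonal) && (q != reject diagonal)}) a :
  delta q a = diagonal_delta (val q) a.
Proof. by []. Qed.

Let stepE := stepE diagonal_deltaE.

Lemma input_inl b : (inl b : tape_symbol diagonal) \in input_alphabet diagonal.
Proof. by rewrite inE. Qed.

Definition input b : input_symbol diagonal :=
  exist (fun c => c \in input_alphabet diagonal) (inl b) (input_inl b).

(** The enumeration of a sum lists the left summand first, and that of [bool] starts with [true]; so
    these two numbers do not depend on [D]. *)
Lemma index_of_inl b : index_of (inl b : tape_symbol diagonal) = ~~ b.
Proof.
rewrite -index_of_enum.
have -> : enum (tape_symbol diagonal) =
          map inl [:: true; false] ++ map inr (enum (tape_symbol D)).
  have enum_bool : Finite.enum bool = [:: true; false] by rewrite unlock.
  by rewrite !enumT {1}unlock /= /sum_enum enum_bool.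
by case: b.
Qed.

Definition code b := rcons (nseq (~~ b) true) false.

Lemma encode_diagonal s :
  encode [seq input b | b <- s] =
  bits (machine_numbers diagonal) ++ flatten [seq code b | b <- s].
Proof.
rewrite /encode /bits map_cat flatten_cat; congr (_ ++ flatten _).
rewrite /word_numbers -!map_comp.
by apply: eq_map => b /=; rewrite index_of_inl.
Qed.

(** * The copying phase *)

Lemma bit_neq_blank b : (val (bit b) == blank D) = false.
Proof.
by apply/eqP => eq_b; have := blank_not_input D; rewrite -eq_b (valP (bit b)).
Qed.

(* Bits already copied, bits still to copy, code appended so far. *)
Notation work_tape u v x :=
  (@tape_of diagonal (map digit u ++ map inl v ++ map digit x)).

(** Every code ends in a zero. The head turns back when writing it, and so ends just left of that
    zero. *)
Lemma append_code s b :
  reaches (@Config diagonal (tape_of s) (size s) (inl (Append b)))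
    (@Config diagonal (tape_of (s ++ map digit (code b)))
       (Posz (size (s ++ map digit (nseq (~~ b) true))) - 1)%R (inl Back)).
Proof.
have append0 s' :
  step (@Config diagonal (tape_of s') (size s') (inl (Append true))) =
  @Config diagonal (tape_of (rcons s' (digit false)))
    (Posz (size s') - 1)%R (inl Back).
  by rewrite stepE // tape_ofE nth_default //= eqxx /= write_tape_of_end.
case: b.
  by apply: reaches_step; rewrite append0 cats0 cats1; apply: reaches_refl.
apply: reaches_step; rewrite stepE // tape_ofE nth_default //= eqxx /=.
rewrite write_tape_of_end -PoszD addn1 -(size_rcons s (digit true)).
apply: reaches_step; rewrite append0 -!cats1 -catA; exact: reaches_refl.
Qed.

(** The part of a round shared by [copy_last] and [copy_next], up to the moment when the head turns
    back. *)
Lemma copy_append u b v x :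
  reaches (@Config diagonal (work_tape u (b :: v) x) (size u) (inl Fetch))
    (@Config diagonal (work_tape (rcons u b) v (x ++ code b))
       (Posz (size (rcons u b ++ v ++ x ++ nseq (~~ b) true)) - 1)%R
       (inl Back)).
Proof.
rewrite -(size_map digit u); apply: reaches_step.
rewrite stepE // tape_ofE nth_cat ltnn subnn /= write_tape_of.
rewrite -PoszD addn1 -(size_rcons _ (digit b)) -cat_rcons -map_rcons.
have scan := @scan_right _ _ diagonal_deltaE (inl (Append b))
  (map digit (rcons u b)) (map inl v ++ map digit x) [::].
rewrite cats0 in scan.
apply: reaches_trans (scan _ _ _) _ => // [a|].
  rewrite mem_cat => /orP[] /mapP[c _ ->] //=.
  by rewrite bit_neq_blank.
apply: reaches_trans (append_code _ _) _.
rewrite -!catA -!map_cat !size_cat !size_map !size_cat.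
exact: reaches_refl.
Qed.

(** With no [inl] symbol left, [Back] runs over the whole word to the blank at cell -1, and the step
    right from there starts [D] at cell 0. *)
Lemma copy_last u b x :
  reaches (@Config diagonal (work_tape u [:: b] x) (size u) (inl Fetch))
    (@Config diagonal (work_tape (rcons u b) [::] (x ++ code b)) 0%R
       (inr (start D))).
Proof.
apply: reaches_trans (copy_append _ _ _ _) _ => /=.
have scan := @scan_left _ _ diagonal_deltaE (inl Back) [::]
  (map digit (rcons u b ++ x ++ nseq (~~ b) true)) [:: digit false].
rewrite /= size_map in scan.
rewrite /code -rcons_cat (map_rcons digit (x ++ _)).
rewrite -(cats1 _ (digit false)) catA -map_cat.
apply: reaches_trans (scan _ _ _) _ => // [a /mapP[c _ ->]|].
  by rewrite /= bit_neq_blank.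
set s := _ ++ _.
have cell : @tape_of diagonal s (0%Z - 1)%R = inr (blank D) by rewrite tape_ofE.
(* The blank at cell -1 is rewritten by itself, so the tape is unchanged. *)
apply: reaches_step; rewrite stepE // cell /= eqxx /= -{1}cell write_id.
exact: reaches_refl.
Qed.

(** [Back] stops at the last uncopied symbol, [Rewind] at the last copied one; the next symbol to
    fetch is one cell to the right. *)
Lemma copy_next u b c v x :
  reaches (@Config diagonal (work_tape u [:: b, c & v] x) (size u) (inl Fetch))
    (@Config diagonal (work_tape (rcons u b) (c :: v) (x ++ code b))
       (size (rcons u b)) (inl Fetch)).
Proof.
apply: reaches_trans (copy_append _ _ _ _) _.
(* Coming from the right, the head meets the last uncopied symbol first, so the uncopied block is
   split at its end. *)
rewrite lastI; move: (belast c v) (last c v) => {}v {}c.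
rewrite /code -rcons_cat; move: (x ++ _) => {}x.
have scan_digits := @scan_left _ _ diagonal_deltaE (inl Back)
  (map digit (rcons u b) ++ map inl (rcons v c)) (map digit x) [:: digit false].
rewrite (map_rcons digit x) -(cats1 _ (digit false)).
rewrite -!catA !size_cat !size_map in scan_digits.
rewrite !size_cat.
apply: reaches_trans (scan_digits _ _ _) _ => // [a /mapP[d _ ->]|].
  by rewrite /= bit_neq_blank.
move: (map digit x ++ _) => {scan_digits} s.
rewrite (map_rcons inl) cat_rcons (size_rcons v) addnS -addn1 PoszD addrK.
have scan_inputs := @scan_left _ _ diagonal_deltaE (inl Rewind)
  (map digit (rcons u b)) (map inl v) (inl c :: s).
rewrite size_cat !size_map in scan_inputs.
have size_uv :
    size (rcons u b) + size v = size (map digit (rcons u b) ++ map inl v).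
  by rewrite size_cat !size_map.
apply: reaches_step; rewrite stepE // catA size_uv.
rewrite tape_ofE nth_cat ltnn subnn /= write_tape_of -catA -size_uv.
apply: reaches_trans (scan_inputs _ _ _) _ => // [a /mapP[d _ ->] //|].
rewrite size_rcons -addn1 PoszD addrK map_rcons cat_rcons -(size_map digit u).
apply: reaches_step; rewrite stepE // tape_ofE nth_cat ltnn subnn /=.
rewrite write_tape_of; exact: reaches_refl.
Qed.

Lemma copy b v :
  reaches (initial [seq input b | b <- b :: v])
    (@Config diagonal
       (work_tape (b :: v) [::] (flatten [seq code c | c <- b :: v]))
       0%R (inr (start D))).
Proof.
(* The induction needs an arbitrary stage, with [u] already copied and [x] already appended. *)
suff copy_from u x :
    reaches (@Config diagonal (work_tape u (b :: v) x) (size u) (inl Fetch))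
      (@Config diagonal
         (work_tape (u ++ b :: v) [::]
            (x ++ flatten [seq code c | c <- b :: v]))
         0%R (inr (start D))).
  rewrite /initial initial_tapeE -map_comp.
  by have := copy_from [::] [::]; rewrite /= cats0.
elim: v b u x => [|c v IH] b u x.
  by rewrite /= cats0 cats1; apply: copy_last.
apply: reaches_trans (copy_next _ _ _ _ _) _.
by have := IH c (rcons u b) (x ++ code b); rewrite cat_rcons -catA; apply.
Qed.

(** * Simulation of the decider *)

Definition simulates (C : config D) (C' : config diagonal) :=
  [/\ config_state C' = inr (config_state C), config_head C' = config_head C
    & forall i, config_tape C' i = inr (config_tape C i)].

Lemma simulates_step C C' :
    config_state C \notin [:: accept D; reject D] ->
  simulates C C' -> simulates (step C) (step C').
Proof.
case: C C' => [t h q] [t' h' q'] running [/= -> -> tt'].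
rewrite stepE //=; last first.
  by apply: contra running => /eqP[->]; rewrite !inE eqxx orbT.
rewrite /step /= tt' /=; case: insubP => [q1 _ _|]; last first.
  by rewrite -negb_or !inE in running *; rewrite running.
case: (delta _ _) => [[q2 a] d]; split=> //= i.
apply: etrans (@writeE diagonal _ _ _ _) _.
by rewrite writeE; case: eqP => // _; apply: tt'.
Qed.

(** The number [m] may be smaller than [n]: the simulation is followed only until [D] first halts,
    since after acceptance [D] stays put while [diagonal] moves on. *)
Lemma simulates_halting C C' n :
    simulates C C' ->
    config_state (iter n (@step D) C) \in [:: accept D; reject D] ->
  exists m, config_state (iter m (@step diagonal) C') =
            inr (config_state (iter n (@step D) C)).
Proof.
elim: n C C' => [|n IH] C C' sim; first by exists 0; case: sim.
have [halted|running] := boolP (config_state C \in [:: accept D; reject D]).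
  by rewrite iter_step_halted // => _; exists 0; case: sim.
rewrite iterSr => /(IH _ _ (simulates_step running sim))[m <-].
by exists m.+1; rewrite iterSr.
Qed.

(** [delta] of [D] has no entry at [accept D], so [insub] fails there and the default move to the
    right applies forever. *)
Lemma run_right (C : config diagonal) n :
    config_state C = inr (accept D) ->
  config_state (iter n (@step diagonal) C) = inr (accept D) /\
  config_head (iter n (@step diagonal) C) = (config_head C + Posz n)%R.
Proof.
have right c : diagonal_delta (inr (accept D)) c = (inr (accept D), c, Right).
  by case: c => //= a; rewrite insubN ?eqxx.
move=> qC; elim: n => [|n [IHq IHh]]; first by rewrite addr0.
rewrite iterS; case: (iter n _ C) IHq IHh => t h q /= -> ->.
rewrite stepE ?right //=; last first.
  by apply/eqP => -[] /eqP; apply/negP/accept_neq_reject.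
by rewrite -addn1 PoszD addrA.
Qed.

(** * The diagonal machine on its own description *)

Definition self : word diagonal :=
  [seq input b | b <- bits (machine_numbers diagonal)].

Lemma simulates_initial s :
  simulates (initial [seq bit b | b <- s])
    (@Config diagonal (@tape_of diagonal (map digit s)) 0%R (inr (start D))).
Proof.
split=> // i; apply: etrans (@tape_ofE diagonal _ _) _.
rewrite /= initial_tapeE tape_ofE; case: i => // n.
by elim: s n => [|b s IH] [|n] //=; apply: IH.
Qed.

Lemma self_simulates :
  exists m, simulates (initial [seq bit b | b <- encode self])
              (iter m (@step diagonal) (initial self)).
Proof.
(* [copy] needs a nonempty input; the code of even the first number is nonempty, as it ends in a
   zero. *)
have [b [v selfE]] : exists b v, bits (machine_numbers diagonal) = b :: v.
  by rewrite /machine_numbers /bits /=; case: (#|_|) => [|n] /=; do 2 eexists.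
have [m run] := copy b v; exists m.
(* The tape now holds the machine part followed by its own code, which is [encode self]. *)
rewrite /self selfE run encode_diagonal selfE cat0s -map_cat.
exact: simulates_initial.
Qed.

Lemma self_follows n :
    let q := config_state
      (iter n (@step D) (initial [seq bit b | b <- encode self])) in
    q \in [:: accept D; reject D] ->
  exists m, config_state (iter m (@step diagonal) (initial self)) = inr q.
Proof.
have [m sim] := self_simulates => /= /(simulates_halting sim)[k <-].
by exists (k + m); rewrite iterD.
Qed.

Lemma accepts_self_aperiodic :
  accepts [seq bit b | b <- encode self] -> ~ eventually_periodic self.
Proof.
move=> [n acc] [k [l [lt_kl per]]].
have [|m] := self_follows (n := n); first by rewrite acc inE eqxx.
rewrite acc => right.
(* Running both sides [m] steps further places them [k] and [l] steps after time [m], when the run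
   to the right is under way, so their heads differ. *)
have /(congr1 (@config_head diagonal)) := congr1 (iter m (@step diagonal)) per.
rewrite -!iterD addnC iterD (addnC m) iterD.
rewrite (run_right k right).2 (run_right l right).2.
by move/addrI => [] eq_kl; rewrite eq_kl ltnn in lt_kl.
Qed.

(** [reject D] is halting in [diagonal] too, so the configuration reached there is a fixed point of
    [step]. *)
Lemma rejects_self_periodic :
  rejects [seq bit b | b <- encode self] -> eventually_periodic self.
Proof.
move=> [n rej].
have [|m] := self_follows (n := n); first by rewrite rej !inE eqxx orbT.
rewrite rej => halted; exists m, m.+1; split=> //=.
by rewrite step_halted // halted !inE eqxx orbT.
Qed.

End Diagonal.

Theorem theorem1p1 :
  ~ exists (D : turing_machine) (bit : bool -> input_symbol D),
      injective bit /\ decides bit eventually_periodic.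
Proof.
move=> [D [bit [_ /(_ _ (self bit)) [acc rej]]]].
(* No case distinction on periodicity is made: refuting it forces [D] to reject, and rejection
   yields periodicity. *)
have aperiodic : ~ eventually_periodic (self bit).
  by move=> per; apply: accepts_self_aperiodic (acc per) per.
by apply/aperiodic/rejects_self_periodic/rej.
Qed.
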